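(* Let $p=(r_0,\alpha_0)$ and $q=(r_1,\alpha_1)$ be two points of the $r$-$\alpha$ plane, with $r_0,r_1\ge 2$ and $0\le\alpha_0,\alpha_1<1$, such that $tr(p)=tr(q)$ and $\alpha_0\le\alpha_1$. Then $p\preceq q$.
   Context: Graphs are finite and undirected; parallel edges are allowed, loops are not. A cubic graph is a graph in which every vertex has degree $3$. For real numbers $r\ge 2$ and $\alpha\ge 0$, an $(r,\alpha)$-flow in a directed graph $D=(V,E)$ is an assignment $f:E\to[1,r-1]$ such that for every vertex $x\in V$, $\left|\sum_{e\in E^+(x)}f(e)-\sum_{e\in E^-(x)}f(e)\right|\le\alpha$, where $E^+(x)$, respectively $E^-(x)$, is the set of edges directed from, respectively toward, $x$ in $D$. An undirected graph $G$ admits an $(r,\alpha)$-flow if some orientation of $G$ admits such a flow. $(r,\alpha)\preceq(s,\beta)$ means that every cubic graph which admits an $(r,\alpha)$-flow also admits an $(s,\beta)$-flow. The trace of a point $(r,\alpha)$ with $r\ge2$, $\alpha<1$ is $tr(r,\alpha)=\frac{r-2\alpha}{1-\alpha}$. *)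

(* Defs.v *)
From mathcomp Require Import all_boot all_order all_algebra.
From mathcomp Require Import reals.

Set Implicit Arguments.
Unset Strict Implicit.
Unset Printing Implicit Defensive.

Import Order.TTheory GRing.Theory Num.Theory.

Local Open Scope ring_scope.

(* Several edges may have the same set of ends (parallel edges); the
   cardinality condition excludes loops. *)
Record mgraph (V E : finType) := MGraph {
  ends : E -> {set V};
  ends_card2 : forall e : E, #|ends e| = 2%N
}.

Record digraph (V E : finType) := DiGraph {
  tail : E -> V;
  head : E -> V;
  tail_neq_head : forall e : E, tail e != head e
}.

Definition degree (V E : finType) (G : mgraph V E) (x : V) : nat :=
  #|[set e | x \in ends G e]|.

Definition cubic (V E : finType) (G : mgraph V E) : Prop :=
  forall x : V, degree G x = 3%N.

Definition orientation_of (V E : finType) (G : mgraph V E)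
    (D : digraph V E) : Prop :=
  forall e : E, ends G e = [set tail D e; head D e].

Definition out_edges (V E : finType) (D : digraph V E) (x : V) : {set E} :=
  [set e | tail D e == x].

Definition in_edges (V E : finType) (D : digraph V E) (x : V) : {set E} :=
  [set e | head D e == x].

(* Points of the r-alpha plane are pairs p = (r, alpha). *)
Definition is_flow (R : realType) (p : R * R) (V E : finType)
    (D : digraph V E) (f : E -> R) : Prop :=
  (forall e : E, 1 <= f e <= p.1 - 1) /\
  (forall x : V,
     `| \sum_(e in out_edges D x) f e - \sum_(e in in_edges D x) f e | <= p.2).

Definition admits_flow (R : realType) (p : R * R) (V E : finType)
    (G : mgraph V E) : Prop :=
  exists D : digraph V E,
    orientation_of G D /\ exists f : E -> R, is_flow p D f.

Definition flow_preceq (R : realType) (p q : R * R) : Prop :=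
  forall (V E : finType) (G : mgraph V E),
    cubic G -> admits_flow p G -> admits_flow q G.

Definition trace (R : realType) (p : R * R) : R :=
  (p.1 - 2 * p.2) / (1 - p.2).

(* Main.v *)
Require Import Defs.
From mathcomp Require Import all_boot all_order all_algebra.
From mathcomp Require Import reals ring lra.

(** In the r-alpha plane, the points of a given trace below alpha = 1 lie on a
    line through the point (2, 1) ([trace_segment]).  So the target point is a
    convex combination, with some weight s on the given point and 1 - s on
    (2, 1).  The flow is moved along the same segment, keeping the orientation
    and replacing f by s * f + (1 - s).  This works as soon as the constant
    function 1 is a flow for (2, 1), that is, as soon as the numbers of edges
    leaving and entering each vertex differ by at most 1 ([is_flow_convex]).
    At a vertex of degree 3 this only excludes sources and sinks, and there are
    none: at such a vertex three values, each at least 1, would add up to an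
    imbalance of at least 3, while the imbalance is less than 1
    ([cubic_flow_balanced]). *)

Import Order.TTheory GRing.Theory Num.Theory.
Local Open Scope ring_scope.

Lemma card_out_in_edges (V E : finType) (G : mgraph V E) (D : digraph V E)
    (x : V) :
  orientation_of G D ->
  (#|out_edges D x| + #|in_edges D x|)%N = degree G x.
Proof.
move=> oGD; rewrite /degree.
have -> : [set e | x \in ends G e] = out_edges D x :|: in_edges D x.
  by apply/setP => e; rewrite !inE oGD !inE ![x == _]eq_sym.
rewrite cardsU.
suff -> : out_edges D x :&: in_edges D x = set0 by rewrite cards0 subn0.
apply/setP => e; rewrite !inE; apply/negP => /andP[/eqP tx /eqP hx].
by have := tail_neq_head D e; rewrite tx hx eqxx.
Qed.

Lemma ler_card_sum (R : realType) (E : finType) (A : {set E}) (f : E -> R) :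
  (forall e, 1 <= f e) -> #|A|%:R <= \sum_(e in A) f e.
Proof. by move=> f_ge1; rewrite -sumr_const; apply: ler_sum. Qed.

(** The bound [p.2 < 1] forbids sources and sinks, and 3 is odd, so the two
    numbers of edges are 1 and 2. *)
Lemma cubic_flow_balanced (R : realType) (p : R * R) (V E : finType)
    (G : mgraph V E) (D : digraph V E) (f : E -> R) (x : V) :
  p.2 < 1 -> cubic G -> orientation_of G D -> is_flow p D f ->
  `| #|out_edges D x|%:R - #|in_edges D x|%:R : R | <= 1.
Proof.
move=> p2_lt1 cG oGD [f_bnd f_bal].
have f_ge1 e : 1 <= f e by case/andP: (f_bnd e).
have deg := card_out_in_edges V E G D x oGD; rewrite cG in deg.
have := f_bal x; rewrite ler_norml => /andP[bal_lo bal_hi].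
have out_ge := ler_card_sum R E (out_edges D x) f f_ge1.
have in_ge := ler_card_sum R E (in_edges D x) f f_ge1.
have sum0 (A : {set E}) : #|A| = 0%N -> \sum_(e in A) f e = 0.
  by move/eqP; rewrite cards_eq0 => /eqP ->; rewrite big_set0.
rewrite ler_norml.
move: deg (sum0 (out_edges D x)) (sum0 (in_edges D x)) out_ge in_ge.
case: #|out_edges D x| => [|[|[|[|n]]]] //;
  case: #|in_edges D x| => [|[|[|[|m]]]] //.
- by move=> _ /(_ erefl) out0 _ _ in_ge; lra.
- by move=> *; lra.
- by move=> *; lra.
- by move=> _ _ /(_ erefl) in0 out_ge _; lra.
Qed.

(** [trace p - 2 = (p.1 - 2) / (1 - p.2)] is, up to sign, the inverse slope of
    the line joining [p] to (2, 1), so [q] is on that line.  The weight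
    on [p] is the ratio of the distances of [q] and [p] to the line alpha = 1. *)
Lemma trace_segment (R : realType) (p q : R * R) :
  p.2 < 1 -> q.2 < 1 -> trace p = trace q -> p.2 <= q.2 ->
  exists s : R, [/\ 0 <= s <= 1, q.1 = s * p.1 + (1 - s) * 2
                  & q.2 = s * p.2 + (1 - s)].
Proof.
case: p q => [r a] [t b] /= a_lt1 b_lt1; rewrite /trace /= => tr ab.
have a1 : 1 - a != 0 by rewrite lt0r_neq0 // subr_gt0.
have b1 : 1 - b != 0 by rewrite lt0r_neq0 // subr_gt0.
exists ((1 - b) / (1 - a)); split.
- apply/andP; split; first by rewrite divr_ge0 // subr_ge0 ltW.
  by rewrite ler_pdivrMr ?subr_gt0 // mul1r lerD2l lerN2.
- have -> : t = (t - 2 * b) / (1 - b) * (1 - b) + 2 * b by field.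
  by rewrite -tr; field.
- by field.
Qed.

(** The balance hypothesis says that the constant function 1 is a flow for
    (2, 1); for a fixed orientation, the conditions on a flow and its
    parameters are jointly convex. *)
Lemma is_flow_convex (R : realType) (p q : R * R) (s : R) (V E : finType)
    (D : digraph V E) (f : E -> R) :
  0 <= s <= 1 -> q.1 = s * p.1 + (1 - s) * 2 -> q.2 = s * p.2 + (1 - s) ->
  (forall x, `| #|out_edges D x|%:R - #|in_edges D x|%:R : R | <= 1) ->
  is_flow p D f -> is_flow q D (fun e => s * f e + (1 - s)).
Proof.
move=> /andP[s_ge0 s_le1] q1 q2 bal [f_bnd f_bal]; split=> [e|x].
  by have /andP[f_lo f_hi] := f_bnd e; rewrite q1; apply/andP; split; nra.
have split_sum (A : {set E}) : \sum_(e in A) (s * f e + (1 - s)) =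
    s * \sum_(e in A) f e + (1 - s) * #|A|%:R.
  by rewrite big_split /= sumr_const -mulr_sumr mulr_natr.
rewrite !split_sum opprD addrACA -!mulrBr q2.
apply: (le_trans (ler_normD _ _)); rewrite !normrM.
have s'_ge0 : 0 <= 1 - s by rewrite subr_ge0.
rewrite (ger0_norm s_ge0) (ger0_norm s'_ge0).
by apply: lerD; [exact: ler_wpM2l | exact: ler_piMr].
Qed.

Theorem lemma11 (R : realType) (r0 a0 r1 a1 : R)
  (hr0 : 2 <= r0) (hr1 : 2 <= r1)
  (ha0 : 0 <= a0 < 1) (ha1 : 0 <= a1 < 1)
  (htr : trace (r0, a0) = trace (r1, a1))
  (ha01 : a0 <= a1) :
  flow_preceq (r0, a0) (r1, a1).
Proof.
move=> V E G cG [D [oGD [f flf]]].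
have /andP[_ a0_lt1] := ha0; have /andP[_ a1_lt1] := ha1.
have [s [s01 r1E a1E]] :=
  trace_segment R (r0, a0) (r1, a1) a0_lt1 a1_lt1 htr ha01.
exists D; split=> //; exists (fun e => s * f e + (1 - s)).
apply: (is_flow_convex _ _ _ _ _ _ _ _ s01 r1E a1E _ flf) => x.
exact: (cubic_flow_balanced R (r0, a0) V E G D f x).
Qed.
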